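(* Let $G=\bigoplus_{t=1}^r\mathbb{Z}_{k_t}$ (each $k_t\ge2$, $|G|=\prod_t k_t$), and let $\mathrm{Seq}(G;D)$ be a class of locally restricted compositions over $G$ with span $\sigma$ associated with a digraph $D$ (as defined in the context). Suppose: 1. The greatest common divisor of the lengths of all directed cycles in $D_{\mathcal R}$ equals $1$. 2. For each $1\le t\le r$ there exist a positive integer $\ell$, two recurrent vertices ${\bf u},{\bf v}$, and a nonempty set $\mathcal W_{\mathcal R}$ of directed walks in $D_{\mathcal R}$ of length $\ell$ from ${\bf u}$ to ${\bf v}$ such that: (a) for each walk $W={\bf u}{\bf u}_1\cdots{\bf u}_{\ell-1}{\bf v}\in\mathcal W_{\mathcal R}$, each $1\le j\le \ell-1$ and each $i\ne t$, we have $u_{i,j}=\phi_{i,j}$, where $u_{i,j}$ denotes the $i$-th coordinate of the size vector $|{\bf u}_j|$ and $\phi_{i,j}$ is a number that is the same for all walks in $\mathcal W_{\mathcal R}$; (b) $\gcd\{m-n: m,n\in N\}=1$, where $N=\{u_{t,1}+\cdots+u_{t,\ell-1}:\ {\bf u}{\bf u}_1\cdots{\bf u}_{\ell-1}{\bf v}\in\mathcal W_{\mathcal R}\}$. Let $m=a\sigma+b$ with integers $a\ge1$ and $0\le b<\sigma$, and let $c_m({\bf s},D)$ be the number of $m$-compositions of ${\bf s}\in G$ in $\mathrm{Seq}(G;D)$. Fix $b$ and let $a$ vary, and suppose there is at least one arc in $D$ from $\mathcal R$ to $\mathrm{Seq}_b(G)$. Then there are constants $A>0$, $B>1$ and $0<\theta<1$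 (independent of $m$, possibly depending on $b$) such that $$c_m({\bf s},D)=A\cdot B^m\big(1+O(\theta^m)\big),\qquad m=a\sigma+b,\ m\to\infty.$$
   Context: Elements of $G$ are integer tuples $(x_1,\ldots,x_r)$ with $0\le x_t\le k_t-1$; addition in $G$ is componentwise modulo $k_t$. $\mathrm{Seq}_m(G)=G^m$ is the set of all sequences $({\bf x}_1,\ldots,{\bf x}_m)$ of elements of $G$ (weak $m$-compositions); the size $|({\bf x}_1,\ldots,{\bf x}_m)|$ is the vector $\sum_j {\bf x}_j$ computed with componentwise ordinary integer addition (an element of $\mathbb{Z}_{\ge0}^r$). Definition of locally restricted compositions: let $\sigma\ge1$; let $\varepsilon$ denote the empty composition and $\varepsilon_s$ a distinguished copy of it. Let $\mathcal T=\mathrm{Seq}_0(G)\cup\cdots\cup\mathrm{Seq}_{\sigma-1}(G)$ and let $\mathcal R$ be a nonempty subset of $\mathrm{Seq}_\sigma(G)$. $D$ is a digraph with vertex set the disjoint union $\{\varepsilon_s\}\cup\mathcal R\cup\mathcal T$ such that: (i) there is at least one arc from $\varepsilon_s$ to $\mathcal R$ and at least one arc from $\mathcal R$ to $\mathcal T$; (ii) there are no arcs (including loops) between vertices of $\{\varepsilon_s\}\cup\mathcal T$; (iii) the subdigraph $D_{\mathcal R}$ induced by $\mathcal R$ is strongly connected and has at least two vertices. Vertices of $\mathcal R$ are called recurrent. $\mathrm{Seq}(G;D)$ is the class of compositions obtained by concatenating the vertices (in order) of directed walks in $D$ from $\varepsilon_s$ to a vertex of $\mathcal T$; $\sigma$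 is its span. An $m$-composition of ${\bf s}$ in $\mathrm{Seq}(G;D)$ is a member of $\mathrm{Seq}(G;D)$ with $m$ parts whose sum in $G$ is ${\bf s}$. *)

(* Defs.v *)
From mathcomp Require Import all_boot all_order all_algebra.
From mathcomp Require Import all_classical all_reals all_analysis.

Set Implicit Arguments.
Unset Strict Implicit.
Unset Printing Implicit Defensive.

Import Order.TTheory GRing.Theory Num.Theory.
Import numFieldNormedType.Exports.

Local Open Scope classical_set_scope.
Local Open Scope ring_scope.

(* [set_gcd S g]: g is the nonnegative greatest common divisor of the possibly
   infinite set S of integers (so the gcd of the empty set and of {0} is 0). *)
Definition set_gcd (S : set int) (g : nat) : Prop :=
  (forall x, S x -> (g%:Z %| x)%Z) /\
  (forall d : nat, (forall x, S x -> (d%:Z %| x)%Z) -> (d %| g)%N).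

(* The group Z_(k_1) (+) ... (+) Z_(k_r).  Mathcomp's 'Z_n is the integers
   modulo n only for n > 1, so this is meant for k_t >= 2; the library has no
   zmodType on dependent finite functions, whence the explicit [gsum]. *)
Definition group_of (r : nat) (k : 'I_r -> nat) : finType :=
  {dffun forall t : 'I_r, 'Z_(k t)}.

Definition gsum (r : nat) (k : 'I_r -> nat) (c : seq (group_of k)) :
    group_of k :=
  [ffun t : 'I_r => \sum_(x <- c) (x t : 'Z_(k t))].

(* The t-th coordinate of the size vector |c|: the residues are added as the
   integers 0, ..., k_t - 1, without reduction modulo k_t. *)
Definition size_vec (r : nat) (k : 'I_r -> nat) (c : seq (group_of k))
    (t : 'I_r) : nat :=
  (\sum_(x <- c) val (x t : 'Z_(k t)))%N.

Section Digraph.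
Variables (T : finType) (sigma : nat) (Rset : {set sigma.-tuple T}).

Definition recurrent : finType := {w : sigma.-tuple T | w \in Rset}.

Definition rparts (u : recurrent) : seq T := tval (val u).

(* Since sigma >= 1, the sequences of length at most sigma - 1 are exactly
   those of Seq_0, ..., Seq_(sigma - 1); they include the empty composition,
   which is thus distinct from the source [Eps]. *)
Inductive vertex :=
  | Eps
  | Rec (u : recurrent)
  | Term (w : (sigma.-1).-bseq T).

Definition is_rec (x : vertex) : bool := if x is Rec _ then true else false.

Variable D : rel vertex.

Definition DR : rel recurrent := fun u v => D (Rec u) (Rec v).

Record locally_restricted : Prop := LocallyRestricted {
  lr_start : exists u, D Eps (Rec u);
  lr_stop : exists u w, D (Rec u) (Term w);
  lr_noarc : forall x y, ~~ is_rec x -> ~~ is_rec y -> ~~ D x y;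
  lr_connected : forall u v, connect DR u v;
  lr_card : (1 < #|recurrent|)%N
}.

(* The lengths of the directed (simple) cycles of D_R; a loop is a cycle of
   length 1. *)
Definition cycle_length (n : nat) : Prop :=
  exists p : seq recurrent, [/\ (0 < size p)%N, ucycle DR p & size p = n].

(* The class Seq(G; D).  A walk from the source to a terminal vertex leaves the
   source once and stops as soon as it reaches a terminal vertex, so that its
   interior vertices are recurrent: a composition with m = a sigma + b parts is
   a blocks of sigma parts followed by a terminal block of b parts.  Arcs of D
   into the source or out of a terminal vertex, if any, play no role. *)
Definition in_class (c : seq T) : Prop :=
  exists (p : seq recurrent) (w : (sigma.-1).-bseq T),
    path D Eps (rcons (map Rec p) (Term w)) /\
    c = flatten (map rparts p) ++ w.

(* A walk u u_1 ... u_(l-1) v of length l >= 1 in D_R, given by its interior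
   vertices u_1, ..., u_(l-1). *)
Definition walk_between (l : nat) (u v : recurrent) (p : l.-1.-tuple recurrent)
    : bool :=
  path DR u (rcons p v).

End Digraph.

Arguments Eps {T sigma Rset}.
Arguments Term {T sigma Rset} w.

(* The set N of total sizes, in coordinate t, of the interiors of the walks
   in W. *)
Definition interior_sums (r : nat) (k : 'I_r -> nat) (sigma : nat)
    (Rset : {set sigma.-tuple (group_of k)}) (t : 'I_r) (l : nat)
    (W : {set l.-1.-tuple (recurrent Rset)}) : set nat :=
  [set n | exists2 p, p \in W &
     n = (\sum_(j < l.-1) size_vec (rparts (tnth p j)) t)%N].

Definition coordinate_condition (r : nat) (k : 'I_r -> nat) (sigma : nat)
    (Rset : {set sigma.-tuple (group_of k)}) (D : rel (vertex Rset))
    (t : 'I_r) : Prop :=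
  exists (l : nat) (u v : recurrent Rset)
         (W : {set l.-1.-tuple (recurrent Rset)}),
    [/\ (0 < l)%N,
        W != finset.set0,
        (forall p, p \in W -> walk_between D u v p),
        (exists phi : 'I_r -> 'I_l.-1 -> nat,
           forall p, p \in W -> forall (j : 'I_l.-1) (i : 'I_r), i != t ->
             size_vec (rparts (tnth p j)) i = phi i j) &
        set_gcd [set d : int | exists m n : nat,
                   [/\ interior_sums t W m, interior_sums t W n &
                       d = m%:Z - n%:Z]] 1].

(* c_m(s, D): compositions are counted, not walks. *)
Definition num_comp (r : nat) (k : 'I_r -> nat) (sigma : nat)
    (Rset : {set sigma.-tuple (group_of k)}) (D : rel (vertex Rset))
    (m : nat) (s : group_of k) : nat :=
  #|[pred c : m.-tuple (group_of k) | `[< in_class D c >] && (gsum c == s)]|.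

(* Main.v *)
Require Import Defs.
From HB Require Import structures.
From mathcomp Require Import all_boot all_order all_algebra.
From mathcomp Require Import all_classical all_reals all_analysis.
From mathcomp Require Import zify ring lra.

Set Implicit Arguments.
Unset Strict Implicit.
Unset Printing Implicit Defensive.

Import Order.TTheory GRing.Theory Num.Theory.
Import numFieldNormedType.Exports.

Local Open Scope classical_set_scope.
Local Open Scope ring_scope.

(* Let [V] be the set of recurrent vertices.  A composition with [a] blocks is a
   walk of length [a - 1] in the extension of [D_R] with vertex set [V * G],
   whose second coordinate records the part of the sum that is still missing.
   The walk differences supplied by the coordinate condition generate [G], and
   [D_R] is aperiodic, so some power of the adjacency matrix of the extension
   is positive.  By Doeblin's contraction of ratios, the iterates of any
   nonnegative nonzero vector then approach a multiple of a positive
   eigenvector at a geometric rate.  The Perron eigenvector of [D_R] (itself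
   obtained from this contraction), extended constantly along [G], is such an
   eigenvector; hence the leading term does not depend on the sum [s]. *)

(** * Uniform bounds on finite families and a limit argument *)

Lemma finite_lower_bound (R : realFieldType) (I : finType) (f : I -> R) :
  (forall i, 0 < f i) -> exists2 a, 0 < a & forall i, a <= f i.
Proof.
move=> f_gt0.
have sum_ge0 (P : pred I) : 0 <= \sum_(i | P i) (f i)^-1.
  by apply: sumr_ge0 => i _; rewrite invr_ge0 ltW.
have den_gt0 : 0 < 1 + \sum_i (f i)^-1 by rewrite ltr_pwDl.
(* The reciprocal of a number dominating every [(f i)^-1]; the summand 1 covers an empty [I]. *)
exists (1 + \sum_i (f i)^-1)^-1 => [|i]; first by rewrite invr_gt0.
rewrite -[leRHS]invrK lef_pV2 ?posrE ?invr_gt0 // (bigD1 i) //=.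
by have := sum_ge0 (fun j => j != i); lra.
Qed.

Lemma finite_upper_bound (R : realFieldType) (I : finType) (f : I -> R) :
  exists2 b, 0 < b & forall i, f i <= b.
Proof.
have sum_ge0 (P : pred I) : 0 <= \sum_(i | P i) `|f i| by exact: sumr_ge0.
exists (1 + \sum_i `|f i|) => [|i]; first by rewrite ltr_pwDl.
rewrite (bigD1 i) //=.
by have := sum_ge0 (fun j => j != i); have := ler_norm (f i); lra.
Qed.

(** Turns approximate identities with a geometric error into exact ones, since the bounded quantity
    does not depend on [n]. *)
Lemma geometric_small (R : realType) (C rho z : R) :
  0 < rho -> rho < 1 -> (forall n, z <= C * rho ^+ n) -> z <= 0.
Proof.
move=> rho_gt0 rho_lt1 zle.
have cvgC : (fun n => C * rho ^+ n) @ \oo --> (C * 0 : R).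
  apply: cvgM; first exact: cvg_cst.
  by apply: cvg_expr; rewrite gtr0_norm.
rewrite mulr0 in cvgC.
have -> : 0 = lim ((fun n => C * rho ^+ n : R) @ \oo) by rewrite (cvg_lim _ cvgC).
apply: limr_ge; first by apply/cvg_ex; exists 0.
by near=> n; exact: zle.
Unshelve. all: by end_near. Qed.

(** * Nonnegative kernels and Doeblin's contraction *)

Section Kernel.
Variables (R : realType) (V : finType).
Implicit Types (K Q : V -> V -> R) (x y : V -> R).

Definition kernel_op K x : V -> R := fun i => \sum_j K i j * x j.

Definition basis_fun (j i : V) : R := (i == j)%:R.

(** The matrix power, built column by column from basis vectors, so that powers and iterates share
    one recursion. *)
Definition kernel_pow K n (i j : V) : R := iter n (kernel_op K) (basis_fun j) i.

#[global] Arguments kernel_pow : simpl never.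

Lemma kernel_pow0 K i j : kernel_pow K 0 i j = (i == j)%:R.
Proof. by []. Qed.

Lemma kernel_powS K n i j :
  kernel_pow K n.+1 i j = \sum_l K i l * kernel_pow K n l j.
Proof. by []. Qed.

Lemma iter_kernel_op K n x i :
  iter n (kernel_op K) x i = \sum_j kernel_pow K n i j * x j.
Proof.
elim: n i => [|n IHn] i.
  rewrite (bigD1 i) //= kernel_pow0 eqxx mul1r big1 ?addr0 // => j ne_ji.
  by rewrite kernel_pow0 eq_sym (negPf ne_ji) mul0r.
rewrite iterS /kernel_op (eq_bigr _ (fun j _ => congr1 _ (IHn j))).
under eq_bigr do rewrite mulr_sumr.
rewrite exchange_big /=; apply: eq_bigr => j _.
by rewrite kernel_powS mulr_suml; apply: eq_bigr => l _; rewrite mulrA.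
Qed.

Lemma kernel_powSr K n i j :
  kernel_pow K n.+1 i j = \sum_l kernel_pow K n i l * K l j.
Proof.
rewrite /kernel_pow iterSr iter_kernel_op; apply: eq_bigr => l _; congr (_ * _).
rewrite /kernel_op (bigD1 j) //= /basis_fun eqxx mulr1 big1 ?addr0 // => k ne_kj.
by rewrite (negPf ne_kj) mulr0.
Qed.

Lemma kernel_pow_ge0 K n i j :
  (forall i j, 0 <= K i j) -> 0 <= kernel_pow K n i j.
Proof.
move=> K_ge0; elim: n i => [|n IHn] i; first exact: ler0n.
by rewrite kernel_powS sumr_ge0 // => l _; rewrite mulr_ge0.
Qed.

Lemma kernel_le Q x y l i : (forall i j, 0 <= Q i j) ->
  (forall j, l * y j <= x j) ->
  l * \sum_j Q i j * y j <= \sum_j Q i j * x j.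
Proof.
move=> Q_ge0 le_yx; rewrite mulr_sumr ler_sum // => j _.
by rewrite mulrCA ler_wpM2l.
Qed.

Lemma kernel_ge Q x y u i : (forall i j, 0 <= Q i j) ->
  (forall j, x j <= u * y j) ->
  \sum_j Q i j * x j <= u * \sum_j Q i j * y j.
Proof.
move=> Q_ge0 le_xy; rewrite mulr_sumr ler_sum // => j _.
by rewrite mulrCA ler_wpM2l.
Qed.

(* Doeblin: the ratio [(Q x) i / (Q y) i] averages the ratios [x j / y j] with
   weights at least [delta * y j / \sum_k y k], and this minorant does not
   depend on [i]. *)
Lemma doeblin_step Q (alpha delta : R) x y l u :
  0 <= alpha -> 0 <= delta ->
  (forall i j, alpha <= Q i j) -> (forall i j, delta * Q i j <= alpha) ->
  (exists i : V, True) -> (forall j, 0 < y j) ->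
  (forall j, l * y j <= x j) -> (forall j, x j <= u * y j) ->
  exists l' u', [/\ u' - l' = (1 - delta) * (u - l),
    forall i, l' * (\sum_j Q i j * y j) <= \sum_j Q i j * x j &
    forall i, \sum_j Q i j * x j <= u' * (\sum_j Q i j * y j)].
Proof.
move=> alpha_ge0 delta_ge0 alphaQ deltaQ [i0 _] y_gt0 lyx xuy.
pose X := \sum_j x j; pose Y := \sum_j y j.
have Y_gt0 : 0 < Y.
  rewrite /Y (bigD1 i0) //= ltr_pwDl //.
  by apply: sumr_ge0 => j _; exact: ltW.
pose m := X / Y.
have mY : m * Y = X by rewrite /m divfK // gt_eqF.
have lm : l <= m by rewrite ler_pdivlMr // mulr_sumr ler_sum.
have mu : m <= u by rewrite ler_pdivrMr // mulr_sumr ler_sum.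
have deltaY i : delta * (\sum_j Q i j * y j) <= alpha * Y.
  rewrite !mulr_sumr ler_sum // => j _.
  by rewrite mulrA ler_wpM2r // ltW.
(* Both ends move towards the mean ratio [m] by the fraction [delta], so the width shrinks by
   exactly [1 - delta]. *)
exists (l + delta * (m - l)), (u - delta * (u - m)); split=> [|i|i].
- by ring.
- have : alpha * (X - l * Y) <= \sum_j Q i j * x j - l * \sum_j Q i j * y j.
    rewrite /X /Y !mulr_sumr -!sumrB mulr_sumr ler_sum // => j _.
    have -> : Q i j * x j - l * (Q i j * y j) = Q i j * (x j - l * y j) by ring.
    by rewrite ler_wpM2r // subr_ge0.
  have : (m - l) * (delta * \sum_j Q i j * y j) <= (m - l) * (alpha * Y).
    by rewrite ler_wpM2l // subr_ge0.
  by rewrite -mY; lra.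
- have : alpha * (u * Y - X) <= u * (\sum_j Q i j * y j) - \sum_j Q i j * x j.
    rewrite /X /Y !mulr_sumr -!sumrB mulr_sumr ler_sum // => j _.
    have -> : u * (Q i j * y j) - Q i j * x j = Q i j * (u * y j - x j) by ring.
    by rewrite ler_wpM2r // subr_ge0.
  have : (u - m) * (delta * \sum_j Q i j * y j) <= (u - m) * (alpha * Y).
    by rewrite ler_wpM2l // subr_ge0.
  by rewrite -mY; lra.
Qed.

End Kernel.

(** * Roots and geometric rates *)

Lemma nth_root_exists (R : realType) (z : R) (n : nat) :
  0 < z -> (0 < n)%N -> exists2 w, 0 < w & w ^+ n = z.
Proof.
move=> z_gt0 n_gt0; exists (z `^ (n%:R^-1)); first exact: powR_gt0.
rewrite -powR_mulrn ?powR_ge0 // -powRrM mulVf ?powRr1 ?ltW //.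
by rewrite pnatr_eq0 -lt0n.
Qed.

(** Converts a contraction per [N.+1] steps into a rate per step: [rho] is the root of [q] of order
    [N.+1], and [C = rho ^- N] absorbs the at most [N] leftover steps. *)
Lemma geometric_root (R : realType) (q : R) (N : nat) :
  0 < q -> q < 1 -> exists rho C,
    [/\ 0 < rho, rho < 1, 0 < C & forall n, q ^+ (n %/ N.+1) <= C * rho ^+ n].
Proof.
move=> q_gt0 q_lt1; have [rho rho_gt0 rhoN] := nth_root_exists q_gt0 (ltn0Sn N).
have rho_lt1 : rho < 1.
  rewrite ltNge; apply/negP => rho_ge1.
  by have := exprn_ege1 N.+1 rho_ge1; rewrite rhoN leNgt q_lt1.
exists rho, (rho ^- N); split=> // [|n]; first by rewrite invr_gt0 exprn_gt0.
rewrite mulrC ler_pdivlMr ?exprn_gt0 // -rhoN -exprM -exprD.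
apply: ler_wiXn2l; [exact: ltW|exact: ltW|].
by have := divn_eq n N.+1; have := ltn_pmod n (ltn0Sn N); lia.
Qed.

(** * Convergence of ratios of iterates *)

Section RatioConvergence.
Variables (R : realType) (V : finType) (K : V -> V -> R) (N : nat).
Hypothesis V_inhabited : exists i : V, True.
Hypothesis K_ge0 : forall i j, 0 <= K i j.
Hypothesis K_primitive : forall i j, 0 < kernel_pow K N.+1 i j.

(** A zero value at [i] would force the whole row [i] of [K] to vanish, and with it the diagonal
    entry at [i] of the positive power. *)
Lemma iter_kernel_op_gt0 y n i :
  (forall j, 0 < y j) -> 0 < iter n (kernel_op K) y i.
Proof.
move=> y_gt0; elim: n i => [//|n IHn] i; rewrite iterS /kernel_op.
have term_ge0 j : 0 <= K i j * iter n (kernel_op K) y j.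
  by rewrite mulr_ge0 // ltW.
rewrite lt_neqAle sumr_ge0 // andbT; apply/negP => /eqP /esym/eqP.
rewrite psumr_eq0 // => /allP all0.
have := K_primitive i i; rewrite kernel_powS big1 ?ltxx // => j _.
have := all0 j (mem_index_enum j); rewrite /= mulf_eq0.
by rewrite (gt_eqF (IHn j)) orbF => /eqP ->; rewrite mul0r.
Qed.

Variables x y : V -> R.
Hypothesis y_gt0 : forall j, 0 < y j.

Let x_ n := iter n (kernel_op K) x.
Let y_ n := iter n (kernel_op K) y.

Definition sandwiched n (l u : R) :=
  forall i, l * y_ n i <= x_ n i /\ x_ n i <= u * y_ n i.

Lemma minorant_add n m l :
  (forall i, l * y_ n i <= x_ n i) -> forall i, l * y_ (n + m) i <= x_ (n + m) i.
Proof.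
move=> lyx; elim: m => [|m IHm] i; first by rewrite addn0.
by rewrite addnS; apply: kernel_le.
Qed.

Lemma majorant_add n m u :
  (forall i, x_ n i <= u * y_ n i) -> forall i, x_ (n + m) i <= u * y_ (n + m) i.
Proof.
move=> xuy; elim: m => [|m IHm] i; first by rewrite addn0.
by rewrite addnS; apply: kernel_ge.
Qed.

Lemma sandwiched_contract delta alpha : 0 <= alpha -> 0 <= delta ->
  (forall i j, alpha <= kernel_pow K N.+1 i j) ->
  (forall i j, delta * kernel_pow K N.+1 i j <= alpha) ->
  exists D, forall q, exists l u,
    sandwiched (q * N.+1) l u /\ u - l = (1 - delta) ^+ q * D.
Proof.
move=> alpha_ge0 delta_ge0 le_alpha le_delta.
have [b _ b_ub] := finite_upper_bound (fun j => `|x j| / y j).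
(* The initial bracket for the ratios is [[- b, b]], where [b] bounds all [|x j| / y j]. *)
exists (b - - b); elim=> [|q [l [u [lxu ulD]]]].
  exists (- b), b; split=> [i|]; last by rewrite expr0 mul1r.
  have := b_ub i; rewrite ler_pdivrMr // => /(le_trans (ler_norm _)) xb.
  have := b_ub i; rewrite ler_pdivrMr // -normrN => /(le_trans (ler_norm _)).
  by rewrite /x_ /y_ mul0n /=; split=> //; lra.
have [||l' [u' [ulD' l'y u'y]]] := @doeblin_step R V (kernel_pow K N.+1) alpha
  delta (x_ (q * N.+1)) (y_ (q * N.+1)) l u alpha_ge0 delta_ge0
  le_alpha le_delta V_inhabited (fun j => iter_kernel_op_gt0 _ _ y_gt0).
- by move=> j; have [] := lxu j.
- by move=> j; have [] := lxu j.
exists l', u'; split=> [i|]; last by rewrite ulD' ulD exprS mulrA.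
rewrite mulSn /x_ /y_ 2!iterD 2!(iter_kernel_op K N.+1).
by split; [exact: l'y|exact: u'y].
Qed.

(** The limit [c] is the supremum of all lower ratio bounds over all times. Any lower and any upper
    bound persist to a common later time and can be compared there, so [c] lies in every bracket. *)
Lemma ratio_limit delta alpha : 0 <= alpha -> 0 <= delta ->
  (forall i j, alpha <= kernel_pow K N.+1 i j) ->
  (forall i j, delta * kernel_pow K N.+1 i j <= alpha) ->
  exists c D, [/\ 0 <= D,
    forall n i, `|x_ n i - c * y_ n i| <= D * (1 - delta) ^+ (n %/ N.+1) * y_ n i &
    (forall j, 0 <= x j) -> (exists j, 0 < x j) -> 0 < c].
Proof.
move=> alpha_ge0 delta_ge0 le_alpha le_delta.
have [D D_sandwich] := sandwiched_contract alpha_ge0 delta_ge0 le_alpha le_delta.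
have [i0 _] := V_inhabited.
pose E := [set l : R | exists n, forall i, l * y_ n i <= x_ n i]%classic.
have E_le n u l : (forall i, x_ n i <= u * y_ n i) -> E l -> l <= u.
  move=> xuy [n' lyx].
  have := minorant_add n lyx i0; rewrite addnC => /le_trans.
  move=> /(_ _ (majorant_add n' xuy i0)).
  by rewrite ler_pM2r // iter_kernel_op_gt0.
have [l0 [u0 [lxu0 ulD0]]] := D_sandwich 0%N.
have E_l0 : E l0 by exists (0 * N.+1)%N => i; have [] := lxu0 i.
have u0_ub : ubound E u0.
  by move=> l; apply: (E_le (0 * N.+1)%N) => i; have [] := lxu0 i.
have E_sup l : E l -> l <= sup E by apply: ub_le_sup; exists u0.
have sup_E n u : (forall i, x_ n i <= u * y_ n i) -> sup E <= u.
  by move=> xuy; apply: ge_sup; [exists l0|move=> l; exact: E_le xuy].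
exists (sup E), D; split.
- have u0_sup := sup_E _ _ (fun i => proj2 (lxu0 i)); have sup_l0 := E_sup _ E_l0.
  move: ulD0; rewrite expr0 mul1r => <-; rewrite subr_ge0.
  exact: le_trans u0_sup.
- move=> n i; have [l [u [lxu ulD]]] := D_sandwich (n %/ N.+1)%N.
  have l_sup : l <= sup E.
    by apply: E_sup; exists (n %/ N.+1 * N.+1)%N => j; have [] := lxu j.
  have sup_u : sup E <= u by apply: (sup_E _ _ (fun i => proj2 (lxu i))).
  rewrite [D * _]mulrC -ulD.
  have := minorant_add (n %% N.+1) (fun i => proj1 (lxu i)) i.
  have := majorant_add (n %% N.+1) (fun i => proj2 (lxu i)) i.
  rewrite -divn_eq => xu lx; have yn_gt0 := iter_kernel_op_gt0 n i y_gt0.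
  rewrite -/(y_ n) in yn_gt0.
  have : l * y_ n i <= sup E * y_ n i by rewrite ler_pM2r.
  have : sup E * y_ n i <= u * y_ n i by rewrite ler_pM2r.
  by rewrite ler_norml; lra.
(* After [N.+1] steps the iterate of [x] is positive everywhere, which gives a positive lower ratio
   bound, hence a positive supremum. *)
move=> x_ge0 [j xj_gt0].
have x_gt0 i : 0 < x_ N.+1 i / y_ N.+1 i.
  rewrite divr_gt0 ?(iter_kernel_op_gt0 _ _ y_gt0) // /x_ iter_kernel_op (bigD1 j) //.
  rewrite ltr_pwDl ?mulr_gt0 // sumr_ge0 // => l _.
  by rewrite mulr_ge0 // ltW.
have [a a_gt0 a_lb] := finite_lower_bound x_gt0.
apply: lt_le_trans a_gt0 _; apply: E_sup; exists N.+1 => i.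
by rewrite -ler_pdivlMr ?iter_kernel_op_gt0.
Qed.

End RatioConvergence.

(** * Uniform geometric convergence and the Perron eigenvector *)

Section Perron.
Variables (R : realType) (V : finType) (K : V -> V -> R) (N : nat).
Hypothesis V_inhabited : exists i : V, True.
Hypothesis K_ge0 : forall i j, 0 <= K i j.
Hypothesis K_primitive : forall i j, 0 < kernel_pow K N.+1 i j.

Lemma ratio_convergence : exists rho, [/\ 0 < rho, rho < 1 &
  forall x y, (forall j, 0 < y j) -> exists c C,
    (forall n i, `|iter n (kernel_op K) x i - c * iter n (kernel_op K) y i| <=
       C * rho ^+ n * iter n (kernel_op K) y i) /\
    ((forall j, 0 <= x j) -> (exists j, 0 < x j) -> 0 < c)].
Proof.
have [alpha alpha_gt0 alpha_lb] :=
  finite_lower_bound (fun ij : V * V => K_primitive ij.1 ij.2).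
have [beta beta_gt0 beta_ub] :=
  finite_upper_bound (fun ij : V * V => kernel_pow K N.+1 ij.1 ij.2).
have [i0 _] := V_inhabited.
have alpha_le_beta : alpha <= beta := le_trans (alpha_lb (i0, i0)) (beta_ub _).
(* [alpha] and [beta] bound the entries of the positive power from below and above; the factor 2
   keeps [1 - delta] strictly positive. *)
pose delta := alpha / (2 * beta).
have delta_gt0 : 0 < delta by rewrite divr_gt0 // mulr_gt0.
have delta_beta : delta * beta = alpha / 2 by rewrite /delta; field; lra.
have delta_lt1 : delta < 1 by rewrite ltr_pdivrMr ?mulr_gt0 // mul1r; lra.
have le_delta i j : delta * kernel_pow K N.+1 i j <= alpha.
  apply: le_trans (_ : delta * beta <= _); last by lra.
  by rewrite ler_wpM2l ?(beta_ub (i, j)) // ltW.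
have [| |rho [C [rho_gt0 rho_lt1 C_gt0 rhoC]]] := @geometric_root R (1 - delta) N.
- by lra.
- by lra.
exists rho; split=> // x y y_gt0.
have [c [D [D_ge0 cD c_gt0]]] := ratio_limit V_inhabited K_ge0 K_primitive x y_gt0
  (ltW alpha_gt0) (ltW delta_gt0)
  (fun i j => alpha_lb (i, j)) le_delta.
exists c, (D * C); split=> // n i; apply: le_trans (cD n i) _.
apply: ler_wpM2r; first by apply/ltW/iter_kernel_op_gt0.
by rewrite -mulrA ler_wpM2l.
Qed.

(* The columns of [K ^ n] all become proportional to the vector of row sums of
   [K ^ n], at the rate given by [ratio_convergence]; the coefficients of
   proportionality form the left eigenvector. *)
Lemma perron_left : exists h lambda,
  (forall i, 0 < h i) /\ forall i, \sum_j h j * K j i = lambda * h i.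
Proof.
have [rho [rho_gt0 rho_lt1 conv]] := ratio_convergence.
have [i0 _] := V_inhabited.
pose S n := iter n (kernel_op K) (fun=> 1) i0.
have S_gt0 n : 0 < S n by exact: iter_kernel_op_gt0.
have [c [C cP]] : exists c C, forall i, 0 < c i /\
    forall n, `|kernel_pow K n i0 i - c i * S n| <= C i * rho ^+ n * S n.
  have /choice [c] : forall i, exists c, exists C, 0 < c /\
      forall n, `|kernel_pow K n i0 i - c * S n| <= C * rho ^+ n * S n.
    move=> i; have [c [C [cC c_gt0]]] := conv (basis_fun R i) (fun=> 1) (fun=> ltr01).
    exists c, C; split=> [|n]; last exact: cC.
    apply: c_gt0 => [j|]; first exact: ler0n.
    by exists i; rewrite /basis_fun eqxx.
  by move=> /choice [C cC]; exists c, C.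
have c_gt0 i : 0 < c i by have [] := cP i.
have C_ge0 i : 0 <= C i.
  have [_ /(_ 0%N) /(le_trans (normr_ge0 _))] := cP i.
  by rewrite expr0 mulr1 pmulr_lge0.
(* The candidate eigenvector [c] multiplied by the kernel; it remains to show that [d] is
   proportional to [c]. *)
pose d i := \sum_l c l * K l i.
have [kappa kappa_gt0 S_le] : exists2 kappa, 0 < kappa & forall n, S n.+1 <= kappa * S n.
  have [b b_gt0 b_ub] := finite_upper_bound (fun i => kernel_op K (fun=> 1) i).
  exists b => // n; rewrite /S iterSr !iter_kernel_op mulr_sumr ler_sum // => j _.
  by rewrite mulr1 mulrC ler_wpM2r // kernel_pow_ge0.
(* The entry [(i0, i)] of the power [n.+1] is estimated twice: directly by [c i * S n.+1], and by
   [d i * S n] after splitting off the last step. *)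
have ratio_near i : exists E, forall n, `|c i * S n.+1 - d i * S n| <= E * rho ^+ n * S n.
  exists (C i * rho * kappa + \sum_l C l * K l i) => n.
  have near1 := proj2 (cP i) n.+1.
  have near2 : `|kernel_pow K n.+1 i0 i - d i * S n| <=
      (\sum_l C l * K l i) * rho ^+ n * S n.
    rewrite kernel_powSr /d !mulr_suml -sumrB (le_trans (ler_norm_sum _ _ _)) //.
    rewrite ler_sum // => l _; have := proj2 (cP l) n.
    have -> : kernel_pow K n i0 l * K l i - c l * K l i * S n =
      (kernel_pow K n i0 l - c l * S n) * K l i by ring.
    rewrite normrM (ger0_norm (K_ge0 l i)) => /(ler_wpM2r (K_ge0 l i)).
    by move/le_trans; apply; rewrite le_eqVlt; apply/orP; left; apply/eqP; ring.
  have : C i * rho ^+ n.+1 * S n.+1 <= C i * rho ^+ n.+1 * (kappa * S n).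
    by rewrite ler_wpM2l // mulr_ge0 // exprn_ge0 // ltW.
  rewrite distrC in near1.
  have := le_trans (ler_distD _ _ _) (lerD near1 near2).
  move=> le1 le2; apply: le_trans le1 _.
  have := lerD le2 (lexx ((\sum_l C l * K l i) * rho ^+ n * S n)).
  move/le_trans; apply.
  by rewrite le_eqVlt; apply/orP; left; apply/eqP; rewrite exprS; ring.
exists c, (d i0 / c i0); split=> // i; rewrite -/(d i).
have [Ei Ei_near] := ratio_near i; have [E0 E0_near] := ratio_near i0.
(* Eliminating [S n.+1] between the estimates for [i] and [i0] bounds a quantity free of [n] by a
   geometric error, so it vanishes. *)
have eq_ratio : c i * d i0 = c i0 * d i.
  apply/eqP; rewrite -subr_eq0 -normr_le0.
  apply: (@geometric_small R (c i0 * Ei + c i * E0) rho) => // n.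
  rewrite -(ler_pM2r (S_gt0 n)) -[X in _ * X <= _](gtr0_norm (S_gt0 n)) -normrM.
  have -> : (c i * d i0 - c i0 * d i) * S n =
    c i0 * (c i * S n.+1 - d i * S n) - c i * (c i0 * S n.+1 - d i0 * S n) by ring.
  apply: le_trans (ler_normB _ _) _; rewrite !normrM (gtr0_norm (c_gt0 i)) (gtr0_norm (c_gt0 i0)).
  have := ler_wpM2l (ltW (c_gt0 i0)) (Ei_near n).
  have := ler_wpM2l (ltW (c_gt0 i)) (E0_near n).
  by lra.
by have := c_gt0 i0 => c0; rewrite mulrAC [d i0 * _]mulrC eq_ratio; field; lra.
Qed.

End Perron.

(** * Numerical semigroups and submonoids of finite groups *)

Lemma numerical_semigroup (S : nat -> Prop) :
  S 0%N -> (forall m n, S m -> S n -> S (m + n)%N) ->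
  (forall d, (forall n, S n -> (d %| n)%N) -> (d %| 1)%N) ->
  exists N, forall n, (N <= n)%N -> S n.
Proof.
move=> S0 SD S_gcd.
have SM q n : S n -> S (q * n)%N.
  by move=> Sn; elim: q => [|q IHq]; rewrite ?mul0n // mulSn; apply: SD.
pose gap d := `[< (0 < d)%N /\ exists n, S n /\ S (n + d)%N >].
have gap_ex : exists d, gap d.
  have [m Sm m_gt0] : exists2 m, S m & (0 < m)%N.
    apply: contrapT => no_pos.
    suff: (2 %| 1)%N by [].
    apply: S_gcd => n Sn; case: (posnP n) => [-> //|n_gt0].
    by case: no_pos; exists n.
  by exists m; apply/asboolP; split=> //; exists 0%N; rewrite add0n.
(* The least gap [d] divides every element of [S], since a nonzero remainder would be a smaller gap.
   Hence [d = 1], and [n] and [n + 1] yield everything from [n * n] on. *)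
case: (ex_minnP gap_ex) => d /asboolP[d_gt0 [n [Sn Snd]]] d_min.
have d_dvd m : S m -> (d %| m)%N.
  move=> Sm; rewrite /dvdn; apply: contraT; rewrite -lt0n => r_gt0.
  have : (d <= m %% d)%N.
    apply: d_min; apply/asboolP; split=> //.
    exists ((m %/ d) * (n + d))%N; split; first exact: SM.
    have -> : ((m %/ d) * (n + d) + m %% d = m + (m %/ d) * n)%N.
      by rewrite {3}(divn_eq m d) mulnDr; lia.
    by apply: SD => //; exact: SM.
  by rewrite leqNgt ltn_mod d_gt0.
have d1 : d = 1%N by apply/eqP; rewrite -dvdn1; exact: S_gcd.
move: Snd; rewrite d1 => Sn1.
exists (n * n)%N => N le_nnN.
have [n0|n_gt0] := posnP n.
  by rewrite -(muln1 N); apply: SM; move: Sn1; rewrite n0.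
have le_nq : (n <= N %/ n)%N by rewrite leq_divRL.
have lt_rn : (N %% n < n)%N by rewrite ltn_mod.
(* With quotient [q] and remainder [r] of [N] by [n], [N = (q - r) * n + r * (n + 1)]; here
   [r < n <= q]. *)
rewrite (_ : N = (N %/ n - N %% n) * n + (N %% n) * (n + 1))%N.
  by apply: SD; exact: SM.
rewrite mulnBl mulnDr muln1 {1}(divn_eq N n).
have : (N %% n * n <= N %/ n * n)%N by rewrite leq_mul2r; apply/orP; right; lia.
lia.
Qed.

Section Submonoid.
Variables (G : finZmodType) (P : G -> Prop).
Hypothesis P0 : P 0.
Hypothesis PD : forall x y, P x -> P y -> P (x + y).

(** Translation by [x] permutes [G], so adding [x] to every summand leaves the sum of all elements
    unchanged. *)
Lemma mulrn_card_eq0 (x : G) : x *+ #|G| = 0.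
Proof.
apply: (addrI (\sum_(g : G) g)); rewrite addr0 -sumr_const -big_split /=.
by rewrite [RHS](reindex_inj (addIr x)).
Qed.

Lemma submonoid_mulrn x n : P x -> P (x *+ n).
Proof.
by move=> Px; elim: n => [|n IHn]; rewrite ?mulr0n // mulrS; apply: PD.
Qed.

Lemma submonoid_opp x : P x -> P (- x).
Proof.
move=> Px; suff -> : - x = x *+ #|G|.-1 by exact: submonoid_mulrn.
apply/eqP; rewrite eq_sym -addr_eq0 -mulrSr prednK ?mulrn_card_eq0 //.
by apply/card_gt0P; exists 0.
Qed.

(** Division with remainder shows that the least positive [d] with [P (x *+ d)] divides every
    element of [S], so [d = 1]. Finiteness of [G] supplies such a [d] and closure under
    opposites. *)
Lemma submonoid_gcd1 (x : G) (S : set int) :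
  set_gcd S 1 -> (forall z, S z -> P (x *~ z)) -> P x.
Proof.
move=> [_ S_gcd] PS.
pose Q d := `[< (0 < d)%N /\ P (x *+ d) >].
have Q_ex : exists d, Q d.
  exists #|G|; apply/asboolP; split; first by apply/card_gt0P; exists 0.
  by rewrite mulrn_card_eq0.
case: (ex_minnP Q_ex) => d /asboolP[d_gt0 Pd] d_min.
suff d1 : d = 1%N by move: Pd; rewrite d1.
apply/eqP; rewrite -dvdn1; apply: S_gcd => z Sz.
have d_neq0 : (d%:Z != 0)%R by rewrite eqz_nat -lt0n.
apply: contraT => d_ndvd.
have mod_ge0 : 0 <= (z %% d%:Z)%Z by exact: modz_ge0.
have [m modE] : exists m : nat, (z %% d%:Z)%Z = m by exists `|(z %% d%:Z)%Z|%N; lia.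
have m_gt0 : (0 < m)%N.
  rewrite lt0n; apply: contra d_ndvd => /eqP m0.
  by apply/dvdz_mod0P; rewrite modE m0.
have lt_md : (m < d)%N by rewrite -ltz_nat -modE ltz_pmod.
suff : (d <= m)%N by rewrite leqNgt lt_md.
apply: d_min; apply/asboolP; split=> //.
have -> : x *+ m = x *~ z - x *~ ((z %/ d%:Z)%Z * d%:Z).
  by rewrite -mulrzBr -[x *+ m]/(x *~ m%:Z) -modE.
apply: PD; first exact: PS.
apply: submonoid_opp; rewrite mulrC mulrzA -[x *~ d%:Z]/(x *+ d).
have Pz y (k : int) : P y -> P (y *~ k).
  move=> Py; case: k => n; first exact: submonoid_mulrn.
  by rewrite NegzE mulrNz; exact/submonoid_opp/submonoid_mulrn.
exact: Pz.
Qed.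

End Submonoid.

(** * Walks weighted in a finite abelian group *)

Section WeightedWalks.
Variables (V : finType) (e : rel V) (G : finZmodType) (weight : V -> G).

(** The last vertex is left out of the weight, so that concatenation adds weights without counting
    the junction twice. *)
Definition weighted_walk n (g : G) (u v : V) : Prop :=
  exists p, [/\ path e u p, last u p = v, size p = n &
    \sum_(x <- belast u p) weight x = g].

Lemma weighted_walk0 u : weighted_walk 0 0 u u.
Proof. by exists [::]; rewrite big_nil. Qed.

Lemma weighted_walk_cat m n g h u v w :
  weighted_walk m g u v -> weighted_walk n h v w ->
  weighted_walk (m + n) (g + h) u w.
Proof.
move=> [p [ep lp <- <-]] [q [eq lq <- <-]]; exists (p ++ q).
by rewrite cat_path last_cat size_cat belast_cat big_cat lp ep eq.
Qed.

Lemma weighted_walk_iter k n g u :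
  weighted_walk n g u u -> weighted_walk (k * n) (g *+ k) u u.
Proof.
move=> wn; elim: k => [|k IHk]; first exact: weighted_walk0.
by rewrite mulSn mulrS; exact: weighted_walk_cat wn IHk.
Qed.

Definition walk_difference (x : G) : Prop :=
  exists n g u v, weighted_walk n (g + x) u v /\ weighted_walk n g u v.

Hypothesis connected : forall u v, exists n g, weighted_walk n g u v.
Hypothesis aperiodic : forall u d,
  (forall n g, weighted_walk n g u u -> (d %| n)%N) -> (d %| 1)%N.
Hypothesis differences_generate : forall P : G -> Prop,
  P 0 -> (forall x y, P x -> P y -> P (x + y)) ->
  (forall x, walk_difference x -> P x) -> forall x, P x.

(* The weights [g] for which some length is shared by closed walks at [u] of
   weights [g] and [0] form a submonoid; a difference [x] belongs to it, as
   [y + x, y] can be completed by [#|G| - 1] further closed walks of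
   weight [y]. *)
Lemma closed_walk_full_weight u : exists n, forall g, weighted_walk n g u u.
Proof.
pose P g := exists n, weighted_walk n g u u /\ weighted_walk n 0 u u.
have P0 : P 0 by exists 0%N; split; exact: weighted_walk0.
have PD x y : P x -> P y -> P (x + y).
  move=> [m [mx m0]] [n [ny n0]]; exists (m + n)%N.
  split; first exact: weighted_walk_cat mx ny.
  by rewrite -[0]addr0; exact: weighted_walk_cat m0 n0.
have Pdiff x : walk_difference x -> P x.
  move=> [n [g [v [w [vwx vw]]]]].
  have [m1 [g1 uv]] := connected u v; have [m2 [g2 wu]] := connected w u.
  have uu := weighted_walk_cat (weighted_walk_cat uv vw) wu.
  have uux := weighted_walk_cat (weighted_walk_cat uv vwx) wu.
  have cardG : (#|G| = 1 + #|G|.-1)%N.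
    by rewrite add1n prednK //; apply/card_gt0P; exists 0.
  exists (#|G| * (m1 + n + m2))%N; split; last first.
    by have := weighted_walk_iter #|G| uu; rewrite mulrn_card_eq0.
  have := weighted_walk_cat uux (weighted_walk_iter #|G|.-1 uu).
  rewrite -mulSn -add1n -cardG.
  suff -> : g1 + (g + x) + g2 + (g1 + g + g2) *+ #|G|.-1 = x by [].
  have -> : g1 + (g + x) + g2 = x + (g1 + g + g2) *+ 1.
    by rewrite mulr1n [g + x]addrC addrCA -addrA.
  by rewrite -addrA -mulrnDr -cardG mulrn_card_eq0 addr0.
have /choice [len lenP] := differences_generate P0 PD Pdiff.
(* The total length is the same for all [g]: the closed walk attached to [g] takes weight [g], and
   those attached to other elements take weight 0. *)
exists (\sum_g len g)%N => g; rewrite (bigD1 g) //= -[g in weighted_walk _ g]addr0.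
apply: weighted_walk_cat (proj1 (lenP g)) _.
elim/big_rec: _ => [|h n _ IHn]; first exact: weighted_walk0.
by rewrite -[0]addr0; apply: weighted_walk_cat (proj2 (lenP h)) IHn.
Qed.

(** Every walk passes through [u0]. A closed walk there of adjustable length equalises the lengths
    over all [u] and [v], and one of fixed length [m] and arbitrary weight then corrects the total
    weight. *)
Lemma walk_full_weight (u0 : V) :
  exists n, forall u v g, weighted_walk n.+1 g u v.
Proof.
have [m m_full] := closed_walk_full_weight u0.
have [|||N N_closed] :=
  @numerical_semigroup (fun n => exists g, weighted_walk n g u0 u0).
- by exists 0; exact: weighted_walk0.
- by move=> i j [g gP] [h hP]; exists (g + h); exact: weighted_walk_cat gP hP.
- by move=> d dP; apply: (aperiodic (u := u0)) => n g gP; apply: dP; exists g.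
have /choice [a aP] : forall u, exists n, exists g, weighted_walk n g u u0.
  by move=> u; exact: connected.
have /choice [b bP] : forall v, exists n, exists g, weighted_walk n g u0 v.
  by move=> v; exact: connected.
exists (m + N + \sum_u a u + \sum_v b v)%N => u v g.
have [[gu u_walk] [gv v_walk]] := (aP u, bP v).
have le_a : (a u <= \sum_u a u)%N by rewrite (bigD1 u) //= leq_addr.
have le_b : (b v <= \sum_v b v)%N by rewrite (bigD1 v) //= leq_addr.
have [|h h_walk] := N_closed (N + (\sum_u a u - a u) + (\sum_v b v - b v)).+1; first lia.
have := weighted_walk_cat (weighted_walk_cat (weighted_walk_cat u_walk
  (m_full (- gu + (g - gv - h)))) h_walk) v_walk.
have -> : gu + (- gu + (g - gv - h)) + h + gv = g.
  by rewrite addrA subrr add0r !subrK.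
set k := (X in weighted_walk X).
by have -> : k = (m + N + \sum_u a u + \sum_v b v).+1 by rewrite /k; lia.
Qed.

End WeightedWalks.

(** * Adjacency kernels and their powers *)

Lemma kernel_pow_transpose (R : realType) (V : finType) (K : V -> V -> R) n i j :
  kernel_pow (fun i j => K j i) n i j = kernel_pow K n j i.
Proof.
elim: n i j => [|n IHn] i j; first by rewrite !kernel_pow0 eq_sym.
by rewrite kernel_powS kernel_powSr; apply: eq_bigr => l _; rewrite IHn mulrC.
Qed.

Lemma iter_kernel_op_eigen (R : realType) (V : finType) (K : V -> V -> R) h lambda n :
  kernel_op K h = (fun i => lambda * h i) ->
  iter n (kernel_op K) h = (fun i => lambda ^+ n * h i).
Proof.
move=> Kh; elim: n => [|n IHn]; first by apply/funext => i /=; rewrite mul1r.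
rewrite iterS IHn; apply/funext => i; rewrite exprSr -mulrA.
rewrite -[lambda * h i]/((fun i => lambda * h i) i) -Kh /kernel_op mulr_sumr.
by apply: eq_bigr => j _; rewrite mulrCA.
Qed.

Section AdjacencyKernel.
Variables (R : realType) (V : finType) (e : rel V).

Definition adjacency : V -> V -> R := fun u v => (e u v)%:R.

Lemma adjacency_ge0 u v : 0 <= adjacency u v.
Proof. exact: ler0n. Qed.

Lemma adjacency_pow_ge1 u p :
  path e u p -> 1 <= kernel_pow adjacency (size p) u (last u p).
Proof.
elim: p u => [|v p IHp] u; first by rewrite kernel_pow0 eqxx.
move=> /= /andP[uv /IHp le1]; rewrite kernel_powS (bigD1 v) //=.
rewrite {1}/adjacency uv mul1r (le_trans le1) // lerDl sumr_ge0 // => w _.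
by rewrite mulr_ge0 ?adjacency_ge0 // kernel_pow_ge0 //; exact: adjacency_ge0.
Qed.

Lemma kernel_op_adjacency x u :
  kernel_op adjacency x u = \sum_(v | e u v) x v.
Proof.
by rewrite big_mkcond; apply: eq_bigr => v _; rewrite /adjacency; case: ifP;
  rewrite ?mul1r ?mul0r.
Qed.

End AdjacencyKernel.

(** * Asymptotics in the extension by the group *)

Section WeightedAsymptotics.
Variables (R : realType) (V : finType) (e : rel V) (G : finZmodType).
Variables (weight : V -> G) (N : nat).
Hypothesis full_weight : forall u v g, weighted_walk e weight N.+1 g u v.

(* The second component of a vertex is the weight still to be collected. *)
Definition extension_rel : rel (V * G) :=
  fun ug vh => e ug.1 vh.1 && (vh.2 == ug.2 - weight ug.1).

Let K := adjacency R extension_rel.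

Lemma kernel_op_extension x u g :
  kernel_op K x (u, g) = \sum_(v | e u v) x (v, g - weight u).
Proof.
under [RHS]eq_bigr => v _ do
  rewrite -(big_pred1_eq +%R (g - weight u) (fun h => x (v, h))).
by rewrite kernel_op_adjacency pair_big_dep; apply: eq_big => [[]|[]].
Qed.

Lemma extension_path u p g : path e u p -> exists q,
  [/\ path extension_rel (u, g) q, size q = size p &
      last (u, g) q = (last u p, g - \sum_(x <- belast u p) weight x)].
Proof.
elim: p u g => [|v p IHp] u g /=; first by exists [::]; rewrite big_nil subr0.
move=> /andP[uv /(IHp _ (g - weight u))[q [pq sq lq]]].
exists ((v, g - weight u) :: q); split=> /=; [|by rewrite sq|].
  by rewrite pq /extension_rel /= uv eqxx.
by rewrite lq big_cons opprD addrA.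
Qed.

(** A walk of weight [g - h] from [u] to [v] lifts to one from [(u, g)] to [(v, h)]. *)
Lemma extension_primitive ug vh : 0 < kernel_pow K N.+1 ug vh.
Proof.
case: ug vh => [u g] [v h]; have [p [ep lp sp wp]] := full_weight u v (g - h).
have [q [pq sq lq]] := extension_path g ep.
apply: lt_le_trans ltr01 _; have := adjacency_pow_ge1 R pq.
by rewrite lq sq sp lp wp opprB addrCA subrr addr0.
Qed.

Lemma adjacency_full_pow_ge1 u v : 1 <= kernel_pow (adjacency R e) N.+1 u v.
Proof.
have [p [ep lp sp _]] := full_weight u v 0.
by have := adjacency_pow_ge1 R ep; rewrite lp sp.
Qed.

(** The eigenvector is a left one of the transposed kernel. All entries of the power [N.+1] are at
    least 1, so with a second vertex [u'] the value [lambda ^+ N.+1 * h u] is at least [h u + h u'],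
    which forces [1 < lambda]. *)
Lemma adjacency_perron : (1 < #|V|)%N -> exists (h : V -> R) (lambda : R),
  [/\ forall u, 0 < h u, 1 < lambda &
      forall u, \sum_(v | e u v) h v = lambda * h u].
Proof.
move=> /card_gt1P[u [u' [_ _ neq_uu']]].
have [|||h [lambda [h_gt0 h_eigen]]] :=
  @perron_left R V (fun i j => adjacency R e j i) N.
- by exists u.
- by move=> i j; exact: adjacency_ge0.
- by move=> i j; rewrite kernel_pow_transpose (lt_le_trans ltr01) // adjacency_full_pow_ge1.
have Ah v : \sum_(w | e v w) h w = lambda * h v.
  rewrite -h_eigen -kernel_op_adjacency; apply: eq_bigr => w _; exact: mulrC.
exists h, lambda; split=> //.
have lambda_ge0 : 0 <= lambda.
  rewrite -(pmulr_lge0 _ (h_gt0 u)) -Ah sumr_ge0 // => v _; exact: ltW.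
have kernel_h : kernel_op (adjacency R e) h = (fun v => lambda * h v).
  by apply/funext => v; rewrite kernel_op_adjacency.
have := congr1 (fun x => x u) (iter_kernel_op_eigen N.+1 kernel_h).
rewrite /= -iterS iter_kernel_op => lambdaN.
rewrite ltNge; apply/negP => lambda_le1.
have : lambda ^+ N.+1 * h u <= h u.
  by rewrite ger_pMl // exprn_ile1.
rewrite -lambdaN leNgt => /negP; apply.
have le_sum : \sum_v h v <= \sum_v kernel_pow (adjacency R e) N.+1 u v * h v.
  by apply: ler_sum => v _; rewrite ler_peMl ?adjacency_full_pow_ge1 // ltW.
apply: lt_le_trans le_sum; rewrite (bigD1 u) //= ltrDl (bigD1 u') 1?eq_sym //=.
rewrite ltr_pwDl // sumr_ge0 // => v _; exact: ltW.
Qed.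

(* The Perron eigenvector of [e], constant along the fibres [G], is also an
   eigenvector of the extension: this is why the limit does not depend on the
   weight. *)
Lemma extension_asymptotics (start : pred V) (y : V * G -> R) :
  (1 < #|V|)%N -> (exists u, start u) ->
  (forall ug, 0 <= y ug) -> (exists ug, 0 < y ug) ->
  exists A lambda rho C : R, [/\ 0 < A, 1 < lambda, 0 < rho, rho < 1 &
    forall n g, `|\sum_(u | start u) iter n (kernel_op K) y (u, g) - A * lambda ^+ n|
      <= C * rho ^+ n * lambda ^+ n].
Proof.
move=> card_V [u0 start_u0] y_ge0 y_pos.
have [h [lambda [h_gt0 lambda_gt1 Ah]]] := adjacency_perron card_V.
pose H := fun ug : V * G => h ug.1.
have KH : kernel_op K H = (fun ug => lambda * H ug).
  by apply/funext => -[u g]; rewrite kernel_op_extension; exact: Ah.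
have [|||rho [rho_gt0 rho_lt1 conv]] := @ratio_convergence R _ K N.
- by exists (u0, 0).
- exact: adjacency_ge0.
- exact: extension_primitive.
have [c [C [cC c_gt0]]] := conv y H (fun ug => h_gt0 ug.1).
exists (c * \sum_(u | start u) h u), lambda, rho, (C * \sum_(u | start u) h u).
split=> // [|n g].
  rewrite mulr_gt0 ?c_gt0 // (bigD1 u0) //= ltr_pwDl // sumr_ge0 // => u _.
  exact: ltW.
have -> : c * (\sum_(u | start u) h u) * lambda ^+ n =
    \sum_(u | start u) c * iter n (kernel_op K) H (u, g).
  rewrite (iter_kernel_op_eigen n KH) mulr_sumr mulr_suml.
  by apply: eq_bigr => u _; rewrite /H /=; ring.
have -> : C * (\sum_(u | start u) h u) * rho ^+ n * lambda ^+ n =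
    \sum_(u | start u) C * rho ^+ n * iter n (kernel_op K) H (u, g).
  rewrite (iter_kernel_op_eigen n KH) mulr_sumr !mulr_suml.
  by apply: eq_bigr => u _; rewrite /H /=; ring.
by rewrite -sumrB (le_trans (ler_norm_sum _ _ _)) // ler_sum.
Qed.

End WeightedAsymptotics.

(** * The group of residue tuples *)

Section ResidueGroup.
Variables (r : nat) (k : 'I_r -> nat).

(* A copy of the carrier of [group_of k], which is not a [zmodType]. *)
Definition residue_group : Type := group_of k.

HB.instance Definition _ := Finite.on residue_group.

Definition residue_zero : residue_group := [ffun t : 'I_r => 0 : 'Z_(k t)].
Definition residue_opp (x : residue_group) : residue_group :=
  [ffun t : 'I_r => - x t : 'Z_(k t)].
Definition residue_add (x y : residue_group) : residue_group :=
  [ffun t : 'I_r => x t + y t : 'Z_(k t)].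

Lemma residue_addA : associative residue_add.
Proof. by move=> x y z; apply/ffunP => t; rewrite !ffunE addrA. Qed.
Lemma residue_addC : commutative residue_add.
Proof. by move=> x y; apply/ffunP => t; rewrite !ffunE addrC. Qed.
Lemma residue_add0 : left_id residue_zero residue_add.
Proof. by move=> x; apply/ffunP => t; rewrite !ffunE add0r. Qed.
Lemma residue_addN : left_inverse residue_zero residue_opp residue_add.
Proof. by move=> x; apply/ffunP => t; rewrite !ffunE addNr. Qed.

HB.instance Definition _ := GRing.isZmodule.Build residue_group
  residue_addA residue_addC residue_add0 residue_addN.

Lemma residue_addE (x y : residue_group) t : (x + y) t = x t + y t.
Proof. by rewrite [LHS]ffunE. Qed.

Lemma residue_zeroE t : (0 : residue_group) t = 0.
Proof. by rewrite [LHS]ffunE. Qed.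

Lemma residue_oppE (x : residue_group) t : (- x) t = - x t.
Proof. by rewrite [LHS]ffunE. Qed.

Lemma residue_mulrnE (x : residue_group) n t : (x *+ n) t = x t *+ n.
Proof.
elim: n => [|n IHn]; first by rewrite !mulr0n residue_zeroE.
by rewrite !mulrS residue_addE IHn.
Qed.

Lemma residue_mulrzE (x : residue_group) (z : int) t : (x *~ z) t = x t *~ z.
Proof.
case: z => n; first exact: residue_mulrnE.
by rewrite NegzE !mulrNz residue_oppE; congr (- _); exact: residue_mulrnE.
Qed.

Lemma residue_sumE I (s : seq I) (F : I -> residue_group) t :
  (\sum_(i <- s) F i) t = \sum_(i <- s) F i t.
Proof.
elim: s => [|i s IHs]; first by rewrite !big_nil residue_zeroE.
by rewrite !big_cons residue_addE IHs.
Qed.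

Lemma gsum_cat (c d : seq (group_of k)) :
  gsum (c ++ d) = (gsum c : residue_group) + gsum d :> residue_group.
Proof. by apply/ffunP => t; rewrite residue_addE !ffunE big_cat. Qed.

Lemma gsum_size_vec (c : seq (group_of k)) t :
  gsum c t = (size_vec c t)%:R :> 'Z_(k t).
Proof.
rewrite ffunE /size_vec; elim: c => [|x c IHc]; first by rewrite !big_nil.
by rewrite !big_cons IHc natrD; congr (_ + _); rewrite natr_Zp.
Qed.

Definition residue_unit (t : 'I_r) : residue_group :=
  [ffun i : 'I_r => (i == t)%:R : 'Z_(k i)].

(** Residues are represented by natural numbers, so closure under addition suffices. *)
Lemma residue_unit_generate (P : residue_group -> Prop) :
  P 0 -> (forall x y, P x -> P y -> P (x + y)) ->
  (forall t, P (residue_unit t)) -> forall x, P x.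
Proof.
move=> P0 PD Punit x.
have -> : x = \sum_(t <- enum 'I_r) residue_unit t *+ val (x t : 'Z_(k t)).
  apply/ffunP => i; rewrite residue_sumE big_enum /= (bigD1 i) //=.
  rewrite residue_mulrnE [residue_unit i i]ffunE eqxx big1 ?addr0.
    by rewrite [RHS]natr_Zp.
  move=> t ne_ti; rewrite residue_mulrnE [residue_unit t i]ffunE eq_sym.
  by rewrite (negPf ne_ti) mul0rn.
elim/big_rec: _ => [//|t y _ Py].
exact: PD (submonoid_mulrn P0 PD _ (Punit t)) Py.
Qed.

End ResidueGroup.

(** * Walks on recurrent vertices *)

Section RecurrentWalks.
Variables (r : nat) (k : 'I_r -> nat) (sigma : nat).
Variables (Rset : {set sigma.-tuple (group_of k)}) (D : rel (vertex Rset)).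

Definition block_weight (u : recurrent Rset) : residue_group k := gsum (rparts u).

Let walk := weighted_walk (DR D) block_weight.

Lemma recurrent_connected :
  locally_restricted D -> forall u v, exists n g, walk n g u v.
Proof.
move=> hD u v; have /connectP[p ep lp] := lr_connected hD u v.
by exists (size p), (\sum_(x <- belast u p) block_weight x), p.
Qed.

(** A closed walk at [u] through a vertex [x] of a cycle can be taken with or without the cycle
    inserted; [d] divides both lengths, hence the cycle length. *)
Lemma recurrent_aperiodic : locally_restricted D ->
  set_gcd [set z : int | exists n : nat, cycle_length D n /\ z = n%:Z] 1 ->
  forall u d, (forall n g, walk n g u u -> (d %| n)%N) -> (d %| 1)%N.
Proof.
move=> hD [_ gcd1] u d d_dvd; apply: gcd1 => _ [n [[p [p_gt0 + p_size]] ->]].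
case: p p_gt0 p_size => [//|x p] _ p_size /andP[x_cycle _].
have [a [g ux]] := recurrent_connected hD u x.
have [b [h xu]] := recurrent_connected hD x u.
have [f xx] : exists f, walk n f x x.
  exists (\sum_(y <- belast x (rcons p x)) block_weight y), (rcons p x).
  by rewrite last_rcons size_rcons.
have := d_dvd _ _ (weighted_walk_cat (weighted_walk_cat ux xx) xu).
rewrite -addnA [(n + b)%N]addnC addnA dvdn_addr ?dvdzE //.
exact: d_dvd (weighted_walk_cat ux xu).
Qed.

Lemma sum_block_weight l (p : l.-tuple (recurrent Rset)) t :
  (\sum_(x <- p) block_weight x) t =
    (\sum_(j < l) size_vec (rparts (tnth p j)) t)%:R :> 'Z_(k t).
Proof.
rewrite big_tuple residue_sumE natr_sum.
by apply: eq_bigr => j _; exact: gsum_size_vec.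
Qed.

(** Two walks of [W] share ends and length, and their weights differ only in coordinate [t], by
    [m - n]. Thus [P] holds for these multiples of the unit, whose coefficients have gcd 1. *)
Lemma coordinate_generate (P : residue_group k -> Prop) t :
  P 0 -> (forall x y, P x -> P y -> P (x + y)) ->
  (forall x, walk_difference (DR D) block_weight x -> P x) ->
  coordinate_condition D t -> P (residue_unit k t).
Proof.
move=> P0 PD Pdiff [l [u [v [W [l_gt0 _ W_walk [phi W_phi] W_gcd]]]]].
apply: (submonoid_gcd1 P0 PD W_gcd) => _ [m [n [[p pW ->] [q qW ->] ->]]].
apply: Pdiff.
have walk_of (p' : l.-1.-tuple (recurrent Rset)) : p' \in W ->
    walk l (block_weight u + \sum_(x <- p') block_weight x) u v.
  move=> p'W; exists (rcons p' v); split; first exact: W_walk.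
  - by rewrite last_rcons.
  - by rewrite size_rcons size_tuple prednK.
  - by rewrite belast_rcons big_cons.
exists l, (block_weight u + \sum_(x <- q) block_weight x), u, v.
split; last exact: walk_of.
rewrite -addrA; have := walk_of p pW; congr (weighted_walk _ _ _ (_ + _) _ _).
apply/ffunP => i; rewrite residue_addE residue_mulrzE !sum_block_weight.
rewrite [residue_unit k t i]ffunE; have [->|ne_it] := eqVneq i t.
  by rewrite mulrzBr -!pmulrn addrCA subrr addr0.
rewrite mul0rz addr0; congr (_%:R); apply: eq_bigr => j _.
by rewrite (W_phi _ pW) // (W_phi _ qW).
Qed.

Lemma recurrent_full_weight : locally_restricted D ->
  set_gcd [set z : int | exists n : nat, cycle_length D n /\ z = n%:Z] 1 ->
  (forall t, coordinate_condition D t) ->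
  exists n, forall u v g, walk n.+1 g u v.
Proof.
move=> hD haper hcoord.
have [u0 _] : exists u0 : recurrent Rset, True.
  by have [u _] := lr_start hD; exists u.
apply: walk_full_weight u0.
- exact: recurrent_connected.
- exact: recurrent_aperiodic.
move=> P P0 PD Pdiff; apply: (residue_unit_generate P0 PD) => t.
exact: coordinate_generate.
Qed.

End RecurrentWalks.

(** * Counting compositions by walks *)

Lemma sum_tupleS (T : finType) n (F : seq T -> nat) :
  (\sum_(p : n.+1.-tuple T) F p = \sum_v \sum_(p : n.-tuple T) F (v :: p))%N.
Proof.
rewrite pair_big /= (reindex (fun vp : T * n.-tuple T => [tuple of vp.1 :: vp.2])) //=.
exists (fun p => (thead p, [tuple of behead p])) => [[v p] _|p _] /=.
  by rewrite theadE; congr (_, _); apply: val_inj.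
by rewrite -tuple_eta.
Qed.

Lemma gsum_cat_eq (r : nat) (k : 'I_r -> nat) (c d : seq (group_of k))
    (s : residue_group k) :
  (gsum (c ++ d) == s :> group_of k) = (gsum d == s - (gsum c : residue_group k) :> group_of k).
Proof.
apply/eqP/eqP => [<-|ds]; first by rewrite gsum_cat addrC addKr.
by rewrite gsum_cat ds addrC subrK.
Qed.

Section Counting.
Variables (r : nat) (k : 'I_r -> nat) (sigma : nat).
Variables (Rset : {set sigma.-tuple (group_of k)}) (D : rel (vertex Rset)).
Variable b : nat.
Hypothesis b_lt_sigma : (b < sigma)%N.

Let terminal := (sigma.-1).-bseq (group_of k).

Definition composition (p : seq (recurrent Rset)) (w : terminal) : seq (group_of k) :=
  flatten (map (@rparts _ _ Rset) p) ++ w.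

Lemma size_rparts (u : recurrent Rset) : size (rparts u) = sigma.
Proof. exact: size_tuple. Qed.

Lemma size_composition p w : size (composition p w) = (size p * sigma + size w)%N.
Proof.
rewrite size_cat; congr (_ + _)%N.
elim: p => [//|u p IHp] /=; by rewrite size_cat size_rparts IHp mulSn.
Qed.

(** All recurrent blocks have the same length [sigma], so a composition determines its walk;
    counting compositions thus amounts to counting walks. *)
Lemma composition_inj p p' w w' : size p = size p' ->
  composition p w = composition p' w' -> p = p' /\ w = w'.
Proof.
elim: p p' => [|u p IHp] [|u' p'] //= => [_ /val_inj -> //|[/IHp IH] /eqP].
rewrite /composition /= -!catA eqseq_cat ?size_rparts // => /andP[/eqP uu' /eqP].
by move=> /IH[-> ->]; split=> //; congr (_ :: _); do 2!apply: val_inj.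
Qed.

Definition terminating (x : vertex Rset) (s : group_of k)
    (p : seq (recurrent Rset)) (w : terminal) : bool :=
  [&& path D x (rcons (map (@Rec _ _ Rset) p) (Term w)), size w == b &
      gsum (composition p w) == s].

Lemma num_comp_terminating n s :
  num_comp D (n * sigma + b) s =
  (\sum_(p : n.-tuple (recurrent Rset)) \sum_(w : terminal) terminating Eps s p w)%N.
Proof.
pose good (pw : n.-tuple (recurrent Rset) * terminal) := terminating Eps s pw.1 pw.2.
have -> : (\sum_(p : n.-tuple (recurrent Rset)) \sum_(w : terminal)
    terminating Eps s p w)%N = #|good|.
  by rewrite pair_big /= -sum1_card [RHS]big_mkcond; apply: eq_bigr => -[p w] _;
    rewrite unfold_in /good /=; case: terminating.
rewrite /num_comp [LHS]cardE [RHS]cardE -(size_map val).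
rewrite -(size_map (fun pw : n.-tuple (recurrent Rset) * terminal =>
  composition pw.1 pw.2)).
apply/perm_size/uniq_perm.
- by rewrite map_inj_uniq ?enum_uniq //; exact: val_inj.
- rewrite map_inj_in_uniq ?enum_uniq // => -[p w] [p' w'] _ _ /=.
  move=> /composition_inj[]; first by rewrite !size_tuple.
  by move=> /val_inj -> ->.
move=> c; apply/mapP/mapP => [[c' + ->]|[[p w] + ->]].
  rewrite mem_enum inE => /andP[/asboolP[p [w [pw cE]]] /eqP c's].
  have := size_tuple c'; rewrite cE -/(composition p w) size_composition => size_pw.
  have size_w : (size w < sigma)%N by have := size_bseq w; lia.
  (* Both [size w] and [b] are below [sigma], so uniqueness of Euclidean division identifies the
     number of blocks and the terminal length. *)
  have := edivn_eq (size p) size_w; rewrite size_pw edivn_eq // => -[np bw].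
  have size_p : size p == n by rewrite np.
  exists (Tuple size_p, w); last by [].
  rewrite mem_enum unfold_in /good /terminating /= pw -bw eqxx /=.
  by rewrite /composition -cE c's.
rewrite mem_enum unfold_in /good => /and3P[/= pw /eqP wb /eqP pws].
have size_c : size (composition p w) == (n * sigma + b)%N.
  by rewrite size_composition size_tuple wb.
exists (Tuple size_c); last by [].
rewrite mem_enum inE /= pws eqxx andbT; apply/asboolP.
by exists p, w.
Qed.

(** The target [s] still includes the weight of [u], as does the second coordinate of a vertex of
    the extension; [n] counts the blocks after [u]. *)
Definition count_from n (u : recurrent Rset) (s : residue_group k) : nat :=
  \sum_(p : n.-tuple (recurrent Rset)) \sum_(w : terminal)
     terminating (Rec u) (s - block_weight u)%R p w.

Lemma count_fromS n u s :
  count_from n.+1 u s =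
  (\sum_(v | DR D u v) count_from n v (s - block_weight u)%R)%N.
Proof.
rewrite /count_from (sum_tupleS _ (fun p => \sum_(w : terminal)
  terminating (Rec u) (s - block_weight u)%R p w))%N [RHS]big_mkcond.
apply: eq_bigr => v _; rewrite /terminating /=; case: ifP => uv; last first.
  by rewrite big1 // => p _; rewrite big1 // => w _; rewrite /DR in uv; rewrite uv.
apply: eq_bigr => p _; apply: eq_bigr => w _; rewrite /DR in uv; rewrite uv /=.
congr (nat_of_bool [&& _, _ & _]).
by rewrite /composition /= -catA gsum_cat_eq.
Qed.

Lemma num_comp_count_from n s : num_comp D (n.+1 * sigma + b) s =
  (\sum_(u | D Eps (Rec u)) count_from n u s)%N.
Proof.
rewrite num_comp_terminating (sum_tupleS _ (fun p => \sum_(w : terminal)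
  terminating Eps s p w))%N [RHS]big_mkcond.
apply: eq_bigr => u _; rewrite /terminating /=; case: ifP => Du; last first.
  by rewrite big1 // => p _; rewrite big1 // => w _; rewrite Du.
apply: eq_bigr => p _; apply: eq_bigr => w _; rewrite andTb.
congr (nat_of_bool [&& _, _ & _]).
by rewrite /composition /= -catA gsum_cat_eq.
Qed.

Lemma count_from_iter (R : realType) n u s :
  (count_from n u s)%:R =
  iter n (kernel_op (adjacency R (extension_rel (DR D) (@block_weight _ _ _ Rset))))
    (fun vg => (count_from 0 vg.1 vg.2)%:R) (u, s).
Proof.
elim: n u s => [//|n IHn] u s.
rewrite iterS kernel_op_extension count_fromS natr_sum.
by apply: eq_bigr => v _; rewrite IHn.
Qed.

(** Provides the nonzero entry of the vector to which the kernel is iterated. *)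
Lemma count_from0_gt0 u (w : terminal) : size w = b -> D (Rec u) (Term w) ->
  (0 < count_from 0 u (block_weight u + gsum w)%R)%N.
Proof.
move=> size_w uw.
have uw_term : terminating (Rec u) (block_weight u + gsum w - block_weight u)%R [::] w.
  by rewrite addrC addKr /terminating /= uw size_w !eqxx.
by rewrite /count_from (bigD1 [tuple]) // (bigD1 w) //= !addn_gt0 lt0b uw_term.
Qed.

End Counting.

(** * From growth per block to growth per part *)

Theorem theorem2 (R : realType) (r : nat) (k : 'I_r -> nat)
    (hk : forall t, (2 <= k t)%N)
    (sigma : nat) (hsigma : (1 <= sigma)%N)
    (Rset : {set sigma.-tuple (group_of k)}) (D : rel (vertex Rset))
    (hD : locally_restricted D)
    (haper : set_gcd [set z : int | exists n : nat, cycle_length D n /\ z = n%:Z] 1)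
    (hcoord : forall t : 'I_r, coordinate_condition D t)
    (b : nat) (hb : (b < sigma)%N)
    (harc : exists (u : recurrent Rset) (w : (sigma.-1).-bseq (group_of k)),
        size w = b /\ D (Rec u) (Term w)) :
  exists A B theta : R,
    [/\ 0 < A, 1 < B, 0 < theta & theta < 1] /\
    forall s : group_of k,
      exists err : nat -> R^o,
        (err =O_\oo (fun a : nat => theta ^+ (a * sigma + b) : R^o)) /\
        forall a : nat, (1 <= a)%N ->
          (num_comp D (a * sigma + b) s)%:R =
            A * B ^+ (a * sigma + b) * (1 + err a).
Proof.
have [N full] := recurrent_full_weight hD haper hcoord.
pose y0 ug : R := (count_from D b 0 ug.1 ug.2)%:R.
have [||||A0 [lambda [rho [C [A0_gt0 lambda_gt1 rho_gt0 rho_lt1 asym]]]]] :=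
  @extension_asymptotics R _ _ _ _ _ full (fun u => D Eps (Rec u)) y0.
- exact: lr_card hD.
- exact: lr_start hD.
- by move=> ug; exact: ler0n.
- have [u [w [size_w uw]]] := harc.
  exists (u, block_weight u + gsum w); rewrite /y0 ltr0n.
  exact: count_from0_gt0.
have lambda_gt0 : 0 < lambda by exact: lt_trans ltr01 lambda_gt1.
(* [lambda] and [rho] are rates per block of [sigma] parts; their roots of order [sigma] are the
   rates per part. *)
have [B B_gt0 BE] := nth_root_exists lambda_gt0 hsigma.
have [theta theta_gt0 thetaE] := nth_root_exists rho_gt0 hsigma.
have B_gt1 : 1 < B.
  rewrite ltNge; apply/negP => B_le1.
  by have := exprn_ile1 sigma (ltW B_gt0) B_le1; rewrite BE leNgt lambda_gt1.
have theta_lt1 : theta < 1.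
  rewrite ltNge; apply/negP => theta_ge1.
  by have := exprn_ege1 sigma theta_ge1; rewrite thetaE leNgt rho_lt1.
(* With [a = n.+1] blocks the kernel is applied only [n] times. Dividing by [lambda] corrects this
   shift, and dividing by [B ^+ b] accounts for the terminal parts. *)
have main_term n : A0 / (lambda * B ^+ b) * B ^+ (n.+1 * sigma + b) = A0 * lambda ^+ n.
  rewrite exprD mulnC exprM BE exprS.
  by field; rewrite ?gt_eqF // exprn_gt0.
have main_gt0 n : 0 < A0 * lambda ^+ n by rewrite mulr_gt0 // exprn_gt0.
have rate n : theta ^+ (n.+1 * sigma + b) = rho ^+ n * theta ^+ (sigma + b).
  by rewrite mulSn -addnA addnCA exprD mulnC exprM thetaE.
exists (A0 / (lambda * B ^+ b)), B, theta; split=> // [|s].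
  by split=> //; rewrite divr_gt0 // mulr_gt0 // exprn_gt0.
exists (fun a => (num_comp D (a * sigma + b) s)%:R /
  (A0 / (lambda * B ^+ b) * B ^+ (a * sigma + b)) - 1); split; last first.
  case=> // n _; rewrite main_term addrC subrK mulrC divfK // gt_eqF //.
(* [theta ^+ (sigma + b)] is the offset between [rho ^+ n] and the required rate at [a = n.+1], and
   [A0] comes from dividing by the main term; [|C| + 1] makes the constant positive. *)
apply/eqO_exP; exists ((`|C| + 1) / (A0 * theta ^+ (sigma + b))).
  by rewrite divr_gt0 ?mulr_gt0 ?exprn_gt0 // ltr_wpDl.
near=> a; have a_gt0 : (0 < a)%N by near: a; exact: nbhs_infty_gt.
rewrite -(prednK a_gt0); set n := a.-1.
rewrite main_term rate.
have -> : (num_comp D (n.+1 * sigma + b) s)%:R / (A0 * lambda ^+ n) - 1 =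
    ((num_comp D (n.+1 * sigma + b) s)%:R - A0 * lambda ^+ n) / (A0 * lambda ^+ n).
  by field; rewrite !gt_eqF ?exprn_gt0.
rewrite normrM normfV (gtr0_norm (main_gt0 n)) ler_pdivrMr //.
have -> : (num_comp D (n.+1 * sigma + b) s)%:R =
    \sum_(u | D Eps (Rec u)) iter n (kernel_op (adjacency R
      (extension_rel (DR D) (@block_weight _ _ _ Rset)))) y0 (u, s).
  rewrite num_comp_count_from // natr_sum.
  by apply: eq_bigr => u _; rewrite count_from_iter.
apply: le_trans (asym n s) _.
rewrite (gtr0_norm (_ : 0 < rho ^+ n * theta ^+ (sigma + b))); last first.
  by rewrite mulr_gt0 ?exprn_gt0.
have -> : (`|C| + 1) / (A0 * theta ^+ (sigma + b)) *
    (rho ^+ n * theta ^+ (sigma + b)) * (A0 * lambda ^+ n) =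
    (`|C| + 1) * (rho ^+ n * lambda ^+ n).
  by field; rewrite ?gt_eqF ?exprn_gt0.
rewrite -mulrA ler_wpM2r ?mulr_ge0 ?exprn_ge0 ?ltW //.
by have := ler_norm C; lra.
Unshelve. all: by end_near. Qed.
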